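(* Let $\varepsilon>0$, $\lambda\in(0,\gamma^{-1})$, and run the primal-dual smoothing framework (Algorithm 1, described in the context) with accuracy parameter $$\eta=\frac{\varepsilon^2\lambda(1-\gamma\lambda)}{32\beta_{\mathcal X}^2}.$$ Let $K\ge 1$ be the iteration at which the algorithm terminates, so that it outputs $x_K$. Then $$\|x_K-\operatorname{prox}(q,x_K,\lambda)\|\le \varepsilon\lambda/\beta_{\mathcal X},$$ i.e. $x_K$ is an $\varepsilon$-near-stationary point of $\min_{x\in\mathbb X} q(x)$.
   Context: Problem. $\mathbb X,\mathbb Y$ are finite-dimensional real normed spaces (norms $\|\cdot\|$, dual norms $\|\cdot\|_*$). $r:\mathbb X\to\mathbb R\cup\{+\infty\}$ is closed and convex with $\mathcal X:=\operatorname{dom} r$ nonempty, closed, convex. $\mathcal Y\subseteq\mathbb Y$ is nonempty, convex and compact; $g:\mathcal Y\to\mathbb R$ is convex and continuous. $\mathcal X'\supseteq\mathcal X$, $\mathcal Y'\supseteq\mathcal Y$ are open; $\Phi:\mathcal X'\times\mathcal Y'\to\mathbb R$ is jointly continuous and $\Phi(x,\cdot)$ is concave on $\mathcal Y$ for each $x\in\mathcal X$. Let $f(x):=\max_{y\in\mathcal Y}\Phi(x,y)-g(y)$, $q:=f+r$ (equal to $+\infty$ off $\mathcal X$), $q^*:=\min_{x\in\mathbb X}q(x)$, assumed $>-\infty$. Assumptions: (1) for $y\in\mathcal Y$, $\Phi(\cdot,y)$ is differentiable on $\mathcal X'$ and for $x,x'\in\mathcal X$, $y,y'\in\mathcal Y$: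 $\|\nabla_x\Phi(x,y)-\nabla_x\Phi(x',y)\|_*\le L_{xx}\|x-x'\|$, $\|\nabla_x\Phi(x,y)-\nabla_x\Phi(x,y')\|_*\le L_{xy}\|y-y'\|$. (2) For some $\gamma\in(0,L_{xx}]$, for all $y\in\mathcal Y$, $x,x'\in\mathcal X$: $\Phi(x',y)-\Phi(x,y)-\langle\nabla_x\Phi(x,y),x'-x\rangle\ge-(\gamma/2)\|x'-x\|^2$. (3) For $x\in\mathcal X$, $\Phi(x,\cdot)$ is differentiable on $\mathcal Y'$ and for $x,x'\in\mathcal X$, $y,y'\in\mathcal Y$: $\|\nabla_y\Phi(x,y)-\nabla_y\Phi(x',y)\|_*\le L_{xy}\|x-x'\|$, $\|\nabla_y\Phi(x,y)-\nabla_y\Phi(x,y')\|_*\le L_{yy}\|y-y'\|$. Distance generating functions (DGF). For a nonempty closed convex set $\mathcal U$ in a finite-dimensional normed space $\mathbb U$, $\omega_{\mathcal U}:\mathbb U\to\mathbb R\cup\{+\infty\}$ is a DGF on $\mathcal U$ if it is continuous and 1-strongly convex on $\mathcal U$ and essentially smooth (continuously differentiable on $\operatorname{int}\operatorname{dom}\omega_{\mathcal U}$, with $\|\nabla\omega_{\mathcal U}(u_k)\|_*\to+\infty$ whenever $u_k\in\operatorname{int}\operatorname{dom}\omega_{\mathcal U}$ converges to a boundary point of $\operatorname{dom}\omega_{\mathcal U}$). $D_{\omega_{\mathcal U}}(u',u):=\omega_{\mathcal U}(u')-\omega_{\mathcal U}(u)-\langle\nabla\omega_{\mathcal U}(u),u'-u\rangle$.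 $\omega_{\mathcal X}$ is a DGF on $\mathcal X$ that is twice continuously differentiable on $\operatorname{int}\operatorname{dom}\omega_{\mathcal X}$, with $\mathcal X\subseteq\operatorname{int}\operatorname{dom}\omega_{\mathcal X}$ and $\nabla\omega_{\mathcal X}$ $\beta_{\mathcal X}$-Lipschitz on $\mathcal X$, $\beta_{\mathcal X}\in[1,\infty)$. $\omega_{\mathcal Y}$ is a DGF on $\mathcal Y$, and $R_{\mathcal Y}(\omega_{\mathcal Y}):=\sup_{y\in\mathcal Y}|\omega_{\mathcal Y}(y)|<\infty$ (positive, as implicit in the choice of $\rho$ below). Smoothing. For $\rho>0$: $f_\rho(x):=\max_{y\in\mathcal Y}\Phi(x,y)-g(y)-\rho\,\omega_{\mathcal Y}(y)$ and $q_\rho:=f_\rho+r$. For $0<\lambda<\gamma^{-1}$, $x\in\mathcal X$: $\operatorname{prox}(q,x,\lambda):=\arg\min_{x'\in\mathbb X}q(x')+\lambda^{-1}D_{\omega_{\mathcal X}}(x',x)$ (unique), $Q_\rho^\lambda(x';x):=q_\rho(x')+\lambda^{-1}D_{\omega_{\mathcal X}}(x',x)$, $q_\rho^\lambda(x):=\min_{x'\in\mathbb X}Q_\rho^\lambda(x';x)$. A point $x\in\mathcal X$ is $\varepsilon$-near-stationary if for some $0<\lambda<\gamma^{-1}$, $\|\lambda^{-1}(x-\operatorname{prox}(q,x,\lambda))\|\le\varepsilon/\beta_{\mathcal X}$. Algorithm 1. Input: $\eta>0$, $\lambda\in(0,\gamma^{-1})$, $\rho:=2\eta/R_{\mathcal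 Y}(\omega_{\mathcal Y})$, $x_1\in\mathcal X$. For $k=1,2,\ldots$: find any $x_{k+1}\in\mathcal X$ with $Q_\rho^\lambda(x_{k+1};x_k)\le q_\rho^\lambda(x_k)+\eta$; terminate at the first $k$ for which $\|x_{k+1}-x_k\|\le\sqrt{2\eta/(\lambda^{-1}-\gamma)}$; with $K$ denoting this $k$, output $x_K$. *)

(* Defs.v *)
From HB Require Import structures.
From mathcomp Require Import all_boot all_order all_algebra.
From mathcomp Require Import all_classical all_reals all_analysis.

Set Implicit Arguments.
Unset Strict Implicit.
Unset Printing Implicit Defensive.
Import Order.TTheory GRing.Theory Num.Theory.
Import numFieldNormedType.Exports.

Local Open Scope classical_set_scope.
Local Open Scope ring_scope.

(* Functions U -> R `|` {+oo} are represented as functions f : U -> \bar R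
   together with the hypothesis [forall u, f u != -oo]. *)

Section ConvexAnalysis.
Context {R : realType} {U : normedModType R}.
Implicit Types (f w : U -> \bar R) (h : U -> R) (A : set U).

Definition finite_dimensional :=
  exists (n : nat) (e : 'I_n -> U), forall u, exists c : 'I_n -> R,
    u = \sum_(i < n) c i *: e i.

(* Only applied to continuous linear forms, for which the supremum is finite. *)
Definition dual_norm (phi : U -> R) : R :=
  sup [set `|phi u| | u in [set u : U | `|u| <= 1]].

Definition dom f : set U := [set u | (f u < +oo)%E].

Definition closed_function f :=
  closed [set z : U * R | (f z.1 <= z.2%:E)%E].

Definition convex_efunction f :=
  forall (t : R) u v, 0 < t -> t < 1 ->
    (f (t *: u + (1 - t) *: v)%R
      <= t%:E * f u + (1 - t)%:E * f v)%E.

Definition strongly_convex1_on A f :=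
  forall (t : R) u v, A u -> A v -> 0 < t -> t < 1 ->
    (f (t *: u + (1 - t) *: v)%R
      <= t%:E * f u + (1 - t)%:E * f v
         - (t * (1 - t) / 2 * `|u - v| ^+ 2)%:E)%E.

(* The gradient of h at u is the differential 'd h u, an element of the dual
   space; it is required to depend continuously on u in the dual norm. *)
Definition C1_on A h :=
  forall u, A u -> differentiable h u /\
    dual_norm ('d h v \- 'd h u) @[v --> u] --> (0 : R).

(* In finite dimension the gradient map is continuously differentiable iff
   each of its coordinates u |-> <grad h u, v> is. *)
Definition C2_on A h := C1_on A h /\ forall v, C1_on A (fun u => 'd h u v).

Definition essentially_smooth w :=
  let D := (dom w)° in
  C1_on D (fine \o w) /\
  forall (u_ : nat -> U) (u : U),
    (forall k, D (u_ k)) ->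
    u_ k @[k --> \oo] --> u ->
    (closure (dom w) `\` D) u ->
    dual_norm ('d (fine \o w) (u_ k)) @[k --> \oo] --> +oo.

Definition DGF A w :=
  [/\ forall u, w u != -oo%E,
      {within A, continuous w},
      strongly_convex1_on A w &
      essentially_smooth w].

Definition bregman w (u' u : U) : \bar R :=
  (w u' - w u - ('d (fine \o w) u (u' - u)%R)%:E)%E.

Definition argmin f : set U := [set u | forall v, (f u <= f v)%E].

(* For w a DGF on dom q, q closed, bounded below and gamma-weakly convex, u in
   dom q and 0 < lambda < gamma^-1, this argmin is a singleton, whose element
   [xget] selects; the default value 0 is then irrelevant. *)
Definition prox (q w : U -> \bar R) (u : U) (lambda : R) : U :=
  xget 0 (argmin (fun u' => (q u' + lambda^-1%:E * bregman w u' u)%E)).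

Definition near_stationary (q w : U -> \bar R) A (beta gamma eps : R) (u : U) :=
  A u /\ exists lambda : R, [/\ 0 < lambda, lambda < gamma^-1 &
    `|lambda^-1 *: (u - prox q w u lambda)| <= eps / beta].

End ConvexAnalysis.

Arguments finite_dimensional {R} U.

Section PrimalDualSmoothing.
Context {R : realType} {U V : normedModType R}.
Variables (r : U -> \bar R) (Y : set V) (g : V -> R) (Phi : U -> V -> R).

(* The maxima defining f and f_rho, and the minimum defining q_rho^lambda, are
   rendered as suprema and infima in \bar R. *)
Definition fmax (x : U) : \bar R :=
  ereal_sup [set (Phi x y - g y)%:E | y in Y].

Definition fmax_smooth (wY : V -> \bar R) (rho : R) (x : U) : \bar R :=
  ereal_sup [set ((Phi x y - g y)%:E - rho%:E * wY y)%E | y in Y].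

(* f + r, set to +oo off dom r, where the values of Phi may be meaningless. *)
Definition composite (f : U -> \bar R) : U -> \bar R :=
  patch (fun=> +oo%E) (dom r) (fun x => f x + r x)%E.

Definition DGF_radius (wY : V -> \bar R) : \bar R :=
  ereal_sup [set `|wY y|%E | y in Y].

Definition Qsmooth (wX : U -> \bar R) (wY : V -> \bar R) (rho lambda : R)
    (x' x : U) : \bar R :=
  (composite (fmax_smooth wY rho) x' + lambda^-1%:E * bregman wX x' x)%E.

Definition qsmooth (wX : U -> \bar R) (wY : V -> \bar R) (rho lambda : R)
    (x : U) : \bar R :=
  ereal_inf (range (fun x' => Qsmooth wX wY rho lambda x' x)).

(* x 1, ..., x K.+1 are iterates of the primal-dual smoothing framework, which
   terminates at iteration K and outputs x K; the other values of the sequence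
   x are irrelevant. *)
Definition smoothing_run (wX : U -> \bar R) (wY : V -> \bar R)
    (gamma eta lambda : R) (x : nat -> U) (K : nat) :=
  let rho := 2 * eta / fine (DGF_radius wY) in
  let tol := Num.sqrt (2 * eta / (lambda^-1 - gamma)) in
  [/\ (1 <= K)%N,
      dom r (x 1%N),
      forall k, (1 <= k <= K)%N -> dom r (x k.+1) /\
        (Qsmooth wX wY rho lambda (x k.+1) (x k)
          <= qsmooth wX wY rho lambda (x k) + eta%:E)%E,
      forall k, (1 <= k < K)%N -> tol < `|x k.+1 - x k| &
      `|x K.+1 - x K| <= tol].

End PrimalDualSmoothing.

(* Main.v *)
Require Import Defs.
From HB Require Import structures.
From mathcomp Require Import all_boot all_order all_algebra.
From mathcomp Require Import all_classical all_reals all_analysis.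
From mathcomp Require Import ring lra.

Set Implicit Arguments.
Unset Strict Implicit.
Unset Printing Implicit Defensive.
Import Order.TTheory GRing.Theory Num.Theory.
Import numFieldNormedType.Exports.

Local Open Scope classical_set_scope.
Local Open Scope ring_scope.

(** Let [x] be the output, [y] the iterate after it, [p] the proximal point of
[x], [F u := q u + lambda^-1 * D(u, x)] the proximal objective and [F_rho] its
smoothed version. On the dual set the smoothing term is at most
[rho * R = 2 * eta], so [F] and [F_rho] differ by at most [2 * eta] and an
[eta]-minimizer of [F_rho], such as [y], is a [5 * eta]-minimizer of [F].

In [F] the weak convexity of the coupling, which survives the maximum over
the dual variable ([fmax_weakly_convex]), is outweighed by the strong
convexity of the Bregman term: [F] is strongly convex with modulus
[lambda^-1 - gamma] ([prox_objective_with_modulus]). Hence it grows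
quadratically around its minimizer ([quadratic_growth]), which bounds the
distance from [y] to [p]. The stopping test bounds the distance from [x] to
[y], and the value of [eta] is such that both bounds add up to at most
[eps * lambda / beta] ([near_proximal_point]).

For [p] to be a minimizer at all, [F] has to attain its infimum
([prox_objective_attains_min]). Sublevel sets of [F] are closed, and bounded
because the Bregman term dominates half the squared norm while [q] is bounded
below; in finite dimension they are therefore compact. That compactness comes
from comparing the norm with the coordinates in a basis
([lincomb_coercive]).

Since [q] is [+oo] off [dom r] and finite on it, the analysis is carried out
on real-valued functions restricted to [dom r]; [proxP] is the bridge to the
extended-valued definitions. *)

(** * Compactness in finite dimension *)

Section FiniteDimension.
Context {R : realType} {U : normedModType R}.

Definition lincomb n (e : 'I_n -> U) (c : 'rV[R]_n) : U :=
  \sum_(i < n) c ord0 i *: e i.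

Lemma lincombZ n (e : 'I_n -> U) (a : R) (c : 'rV[R]_n) :
  lincomb e (a *: c) = a *: lincomb e c.
Proof.
by rewrite /lincomb scaler_sumr; apply: eq_bigr => i _; rewrite mxE scalerA.
Qed.

Lemma continuous_lincomb n (e : 'I_n -> U) : continuous (lincomb e).
Proof.
apply: continuous_big => // [|i _ c]; first exact: add_continuous.
by apply: continuousZr_tmp; exact: coord_continuous.
Qed.

(** In a spanning family of minimal length, a vanishing combination with a
nonzero coefficient would allow one vector to be eliminated. *)
Lemma finite_dimensional_basis : finite_dimensional U ->
  exists n (e : 'I_n -> U), (forall u, exists c, u = lincomb e c) /\
    (forall c, lincomb e c = 0 -> c = 0).
Proof.
move=> [n0 [e0 span0]].
pose P n := `[< exists e : 'I_n -> U, forall u, exists c, u = lincomb e c >].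
have [] := @ex_minnP P.
  exists n0; apply/asboolP; exists e0 => u; have [c ->] := span0 u.
  by exists (\row_i c i); apply: eq_bigr => i _; rewrite mxE.
move=> n /asboolP[e span] min_n; exists n, e; split=> // c ec0.
apply/rowP => i; rewrite mxE; apply/eqP/negP => /negP ci0.
suff : P n.-1.
  by move/min_n; rewrite leqNgt prednK ?leqnn// (leq_ltn_trans _ (ltn_ord i)).
apply/asboolP; exists (fun j => e (lift i j)) => u; have [d ->] := span u.
exists (\row_j (d ord0 (lift i j) - d ord0 i / c ord0 i * c ord0 (lift i j))).
have -> : lincomb e d = lincomb e d - (d ord0 i / c ord0 i) *: lincomb e c.
  by rewrite ec0 scaler0 subr0.
rewrite /lincomb scaler_sumr -sumrB (bigD1_ord i)//= scalerA divfK//.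
rewrite subrr add0r.
by apply: eq_bigr => j _; rewrite mxE scalerA -scalerBl.
Qed.

(** The unit sphere of the coefficient space is compact, so the norm of a
combination of independent vectors attains a minimum there, which is
positive. *)
Lemma lincomb_coercive n (e : 'I_n -> U) :
  (forall c, lincomb e c = 0 -> c = 0) ->
  exists2 m : R, 0 < m & forall c, m * `|c| <= `|lincomb e c|.
Proof.
move=> free_e.
have [[c1 c1_neq0]|allc0] := pselect (exists c : 'rV[R]_n, c != 0); last first.
  exists 1 => // c; have [->|c0] := eqVneq c 0; first by rewrite normr0 mulr0.
  by case: allc0; exists c.
pose S := [set c : 'rV[R]_n | `|c| = 1].
have normalize c : c != 0 -> S (`|c|^-1 *: c).
  by move=> c0; rewrite /S /= normrZ normfV normr_id mulVf// normr_eq0.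
have S0 : S !=set0 by exists (`|c1|^-1 *: c1); exact: normalize.
have S_compact : compact S.
  apply: bounded_closed_compact.
    by exists 1; split=> // M M1 c /= ->; exact: ltW.
  rewrite (_ : S = Num.norm @^-1` [set 1]) //.
  apply: preimage_closed => [c _|]; last exact: closed_eq.
  exact: norm_continuous.
have norm_cont : {within S, continuous (fun c => `|lincomb e c|)}.
  apply: continuous_subspaceT => c; apply: continuous_comp.
    exact: continuous_lincomb.
  exact: norm_continuous.
have [c2 /set_mem c2S c2_min] := compact_EVT_min S0 S_compact norm_cont.
exists `|lincomb e c2|.
  rewrite normr_gt0; apply/eqP => /free_e c20.
  by move: c2S; rewrite /S /= c20 normr0 => /esym/eqP; rewrite oner_eq0.
move=> c; have [->|c0] := eqVneq c 0; first by rewrite normr0 mulr0.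
have := c2_min _ (mem_set (normalize _ c0)).
by rewrite lincombZ normrZ normfV normr_id ler_pdivlMl ?normr_gt0// mulrC.
Qed.

Lemma finite_dimensional_bounded_closed_compact (A : set U) :
  finite_dimensional U -> bounded_set A -> closed A -> compact A.
Proof.
move=> /finite_dimensional_basis[n [e [span_e free_e]]] [M [_ A_le]] A_closed.
have [m m_gt0 coercive_e] := lincomb_coercive free_e.
have -> : A = lincomb e @` (lincomb e @^-1` A).
  apply/seteqP; split=> [u Au|_ [c Ac <-]] //.
  by have [c uc] := span_e u; exists c; rewrite //= -uc.
apply: continuous_compact.
  exact: continuous_subspaceT (@continuous_lincomb _ e).
apply: bounded_closed_compact.
  exists ((M + 1) / m); split; first by rewrite num_real.
  move=> N /ltW N_ge c /= /A_le Ac; rewrite (le_trans _ N_ge)// ler_pdivlMr//.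
  by rewrite mulrC (le_trans (coercive_e c))// Ac// ltrDl.
by apply: preimage_closed => // c _; exact: continuous_lincomb.
Qed.

(** A minimizing sequence lies in a compact sublevel set; any of its cluster
points belongs to every sublevel set above the infimum. *)
Lemma coercive_lsc_attains_min (X : set U) (G : U -> R) :
  finite_dimensional U -> X !=set0 ->
  (exists m, forall u, X u -> m <= G u) ->
  (forall a, bounded_set [set u | X u /\ G u <= a]) ->
  (forall a, closed [set u | X u /\ G u <= a]) ->
  exists2 p, X p & forall u, X u -> G p <= G u.
Proof.
move=> finU X0 [m0 m0_le] bnd cls.
pose m := inf (G @` X).
have hasinf : has_inf (G @` X).
  by split; [exact: image_nonempty | exists m0 => _ [u Xu <-]; exact: m0_le].
have /choice[u_ u_min] (k : nat) : exists u, X u /\ G u <= m + k.+1%:R^-1.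
  have k0 : 0 < k.+1%:R^-1 :> R by rewrite invr_gt0.
  have [_ [u Xu <-] /ltW Gu] := inf_adherent k0 hasinf.
  by exists u.
have sub_ev (k : nat) :
    (u_ @ \oo) [set u | X u /\ G u <= m + k.+1%:R^-1].
  exists k => // j /= kj; have [Xu Gu] := u_min j; split=> //.
  by rewrite (le_trans Gu)// lerD2l lef_pV2 ?posrE// ler_nat ltnS.
have := finite_dimensional_bounded_closed_compact finU (bnd _) (cls _).
move=> /(_ _ _ _ (sub_ev 0%N))[p [_ p_cluster]].
have p_sub k : X p /\ G p <= m + k.+1%:R^-1.
  by apply: cls => B Bp; apply: p_cluster => //; exact: sub_ev.
exists p => [|u Xu]; first by case: (p_sub 0%N).
have m_le : m <= G u by apply: ge_inf; [case: hasinf|exists u].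
apply: le_trans m_le; apply/ler_addgt0Pr => d d0.
have [k] := ltr_add_invr d0; rewrite add0r => /ltW kd.
by have [_ /le_trans] := p_sub k; apply; rewrite lerD2l.
Qed.

End FiniteDimension.

(** * Convexity with a modulus of either sign *)

Section ConvexityModulus.
Context {R : realType} {U : normedModType R}.
Implicit Types (X : set U) (G H : U -> R) (c : R).

(** For [0 < c] this is c-strong convexity, for [c = 0] convexity, and for
[c < 0] weak convexity: moduli of any sign add up, which is how the strong
convexity of the Bregman term absorbs the weak convexity of the coupling.
Stability of [X] under convex combinations is part of the notion because the
functions considered are only meaningful on [X]. *)
Definition convex_with_modulus X c G := forall (t : R) u v,
  X u -> X v -> 0 < t -> t < 1 -> X (t *: u + (1 - t) *: v) /\
  G (t *: u + (1 - t) *: v) <=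
    t * G u + (1 - t) * G v - c * (t * (1 - t) / 2 * `|u - v| ^+ 2).

Lemma convex_with_modulusD X c d G H :
  convex_with_modulus X c G -> convex_with_modulus X d H ->
  convex_with_modulus X (c + d) (fun u => G u + H u).
Proof.
move=> GX HX t u v Xu Xv t0 t1.
have [Xz Gz] := GX t u v Xu Xv t0 t1; have [_ Hz] := HX t u v Xu Xv t0 t1.
by split=> //; lra.
Qed.

Lemma convex_with_modulusZ X c a G : 0 <= a ->
  convex_with_modulus X c G -> convex_with_modulus X (a * c) (fun u => a * G u).
Proof.
move=> a0 GX t u v Xu Xv t0 t1; have [Xz Gz] := GX t u v Xu Xv t0 t1.
by split=> //; apply: le_trans (ler_wpM2l a0 Gz) _; lra.
Qed.

Lemma le_of_le_onem_mul (a : R) (b : R) :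
  (forall t, 0 < t -> t < 1 -> a * (1 - t) <= b) -> a <= b.
Proof.
move=> ab.
have : a * (1 - t) @[t --> 0^'+] --> a * (1 - 0).
  apply: cvgMl_tmp; apply: cvgB; first exact: cvg_cst.
  exact: cvg_at_right_filter.
rewrite subr0 mulr1 => /cvgr_to_le; apply.
by near=> t; apply: ab.
Unshelve. all: by end_near. Qed.

(** Comparing the minimum value with the value at a point of the segment from
the minimizer to [u], and letting that point tend to the minimizer, keeps the
full constant [c / 2]; the midpoint alone would give only [c / 4]. *)
Lemma quadratic_growth X c G p u :
  convex_with_modulus X c G -> X p -> (forall v, X v -> G p <= G v) -> X u ->
  c / 2 * `|u - p| ^+ 2 <= G u - G p.
Proof.
move=> GX Xp p_min Xu; apply: le_of_le_onem_mul => t t0 t1.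
have [Xz Gz] := GX t u p Xu Xp t0 t1.
rewrite -(ler_pM2l t0); have := p_min _ Xz; lra.
Qed.

(** The difference quotients of [G] at [x] in the direction [u - x] are bounded
by strong convexity; the directional derivative is their limit. *)
Lemma strongly_convex_gradient_ineq X G x u :
  convex_with_modulus X 1 G -> X x -> differentiable G x -> X u ->
  2^-1 * `|u - x| ^+ 2 <= G u - G x - 'd G x (u - x).
Proof.
move=> GX Xx Gx Xu; apply: le_of_le_onem_mul => s s0 s1.
set b := 2^-1 * _ ^+ 2 * _.
suff : 'd G x (u - x) <= G u - G x - b by lra.
have : h^-1 *: (G (h *: (u - x) + x) - G x) @[h --> 0^'+] --> 'd G x (u - x).
  apply: cvg_dnbhs_at_right; rewrite -deriveE//.
  exact: (@diff_derivable _ _ _ _ _ (u - x) Gx).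
move/cvgr_to_le; apply; near=> t.
have t0 : 0 < t by [].
have ts : t < s by [].
have t1 : t < 1 by exact: lt_trans ts s1.
have [_] := GX t u x Xu Xx t0 t1.
have -> : t *: u + (1 - t) *: x = t *: (u - x) + x.
  by rewrite scalerBr scalerBl scale1r -addrA (addrC (- _)).
move=> Gz; rewrite [_ *: _]mulrC ler_pdivrMr//.
have st : 0 <= (s - t) * `|u - x| ^+ 2.
  by rewrite mulr_ge0 ?sqr_ge0// subr_ge0 ltW.
have b_le : b <= (1 - t) / 2 * `|u - x| ^+ 2 by rewrite /b; lra.
rewrite -(ler_pM2l t0) in b_le; lra.
Unshelve. all: by end_near. Qed.

End ConvexityModulus.

(** * The maximum over the dual variable *)

Section MaxFunction.
Context {R : realType} {U V : normedModType R}.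
Variables (Y : set V) (g : V -> R) (Phi : U -> V -> R).

Lemma fmax_fin_num x M : Y !=set0 -> (forall y, Y y -> Phi x y - g y <= M) ->
  fmax Y g Phi x \is a fin_num.
Proof.
move=> [y0 Yy0] le_M; rewrite fin_numElt; apply/andP; split.
  apply: (@lt_le_trans _ _ (Phi x y0 - g y0)%:E); first exact: ltNyr.
  by apply: ereal_sup_ubound; exists y0.
apply: (@le_lt_trans _ _ M%:E); last exact: ltry.
by apply: ge_ereal_sup => _ [y Yy <-]; rewrite lee_fin le_M.
Qed.

Lemma fine_fmax_le x a : fmax Y g Phi x \is a fin_num ->
  fine (fmax Y g Phi x) <= a <-> forall y, Y y -> Phi x y - g y <= a.
Proof.
move=> fin_x; rewrite -lee_fin fineK//; split=> [le_a y Yy|le_a].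
  by rewrite -lee_fin; apply: le_trans le_a; apply: ereal_sup_ubound; exists y.
by apply: ge_ereal_sup => _ [y Yy <-]; rewrite lee_fin le_a.
Qed.

Lemma le_fine_fmax x y : fmax Y g Phi x \is a fin_num -> Y y ->
  Phi x y - g y <= fine (fmax Y g Phi x).
Proof. by move=> fin_x; move: y; apply/fine_fmax_le. Qed.

(** Smoothing amounts to a change of [g], so facts about [fmax] apply to the
smoothed function as well. *)
Lemma fmax_smoothE (wY : V -> \bar R) rho x :
  (forall y, Y y -> wY y \is a fin_num) ->
  fmax_smooth Y g Phi wY rho x =
    fmax Y (fun y => g y + rho * fine (wY y)) Phi x.
Proof.
move=> wY_fin; congr ereal_sup; apply: eq_imagel => y Yy.
by rewrite -[in LHS](fineK (wY_fin y Yy)) -EFinM -EFinB opprD addrA.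
Qed.

(** A linear lower bound at the intermediate point, up to the quadratic error
[gamma / 2 * |.|^2], gives weak convexity: in the convex combination of the
two bounds the linear terms cancel, and the errors [(1 - t)^2] and [t^2] add
up to the factor [t * (1 - t)]. This survives the maximum over [Y]. *)
Lemma fmax_weakly_convex (X : set U) (gamma : R) (d : U -> V -> U -> R) :
  (forall x y, scalable (d x y : U -> R^o)) ->
  convex_with_modulus X 0 (fun=> 0) ->
  (forall x, X x -> fmax Y g Phi x \is a fin_num) ->
  (forall x x' y, X x -> X x' -> Y y ->
    - (gamma / 2) * `|x' - x| ^+ 2 <= Phi x' y - Phi x y - d x y (x' - x)) ->
  convex_with_modulus X (- gamma) (fun x => fine (fmax Y g Phi x)).
Proof.
move=> d_lin X_convex fin_f lower t u v Xu Xv t0 t1.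
have [Xz _] := X_convex t u v Xu Xv t0 t1; split=> //.
apply/fine_fmax_le => [|y Yy]; first exact: fin_f.
set z := t *: u + (1 - t) *: v in Xz *.
have uz : u - z = (1 - t) *: (u - v).
  by rewrite /z (scalerBr (1 - t)) (scalerBl _ _ u) scale1r opprD addrA.
have vz : v - z = - t *: (u - v).
  apply/eqP; rewrite subr_eq /z scaleNr scalerBr opprB scalerBl scale1r.
  by rewrite addrA subrK addrC subrK.
have t1' : 0 < 1 - t by rewrite subr_gt0.
have leu := lower _ _ _ Xz Xu Yy; have lev := lower _ _ _ Xz Xv Yy.
rewrite uz d_lin normrZ exprMn (gtr0_norm t1') -(ler_pM2l t0) in leu.
rewrite vz d_lin normrZ exprMn normrN (gtr0_norm t0) -(ler_pM2l t1') in lev.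
have fu := le_fine_fmax (fin_f u Xu) Yy.
have fv := le_fine_fmax (fin_f v Xv) Yy.
rewrite -(ler_pM2l t0) in fu; rewrite -(ler_pM2l t1') in fv.
rewrite /GRing.scale/= in leu lev; lra.
Qed.

End MaxFunction.

(** * From extended-valued to real-valued objectives *)

Section ExtendedValued.
Context {R : realType} {U : normedModType R}.
Implicit Types (r w f : U -> \bar R).

Lemma dom_fin_num r u : (forall v, r v != -oo%E) -> dom r u ->
  r u \is a fin_num.
Proof. by move=> r_ninfty ru; rewrite fin_numElt ltNye r_ninfty. Qed.

Lemma convex_efunction_with_modulus r : (forall u, r u != -oo%E) ->
  convex_efunction r -> convex_with_modulus (dom r) 0 (fine \o r).
Proof.
move=> r_ninfty r_convex t u v ru rv t0 t1.
have := r_convex t u v t0 t1; set z := _ + _.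
rewrite -(fineK (dom_fin_num r_ninfty ru)) -(fineK (dom_fin_num r_ninfty rv)).
rewrite -!EFinM -EFinD => rz.
have Xz : dom r z by rewrite /dom /= (le_lt_trans rz)// ltry.
split=> //; rewrite mul0r subr0 -lee_fin.
by rewrite fineK//; exact: dom_fin_num.
Qed.

Lemma strongly_convex1_with_modulus (X : set U) w :
  convex_with_modulus X 0 (fun=> 0) -> (forall u, X u -> w u \is a fin_num) ->
  strongly_convex1_on X w -> convex_with_modulus X 1 (fine \o w).
Proof.
move=> X_convex w_fin w_convex t u v Xu Xv t0 t1.
have [Xz _] := X_convex t u v Xu Xv t0 t1; split=> //.
have := w_convex t u v Xu Xv t0 t1.
rewrite -(fineK (w_fin _ Xu)) -(fineK (w_fin _ Xv)) -(fineK (w_fin _ Xz)).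
by rewrite -!EFinM -!EFinD lee_fin mul1r.
Qed.

(** The points [(u, a - H u)] depend continuously on [u] and lie in the closed
epigraph of [r] exactly when [u] is in the sublevel set. *)
Lemma closed_sublevelD r (H : U -> R) a : (forall u, r u != -oo%E) ->
  closed_function r -> closed (dom r) ->
  (forall u, dom r u -> {for u, continuous H}) ->
  closed [set u | dom r u /\ fine (r u) + H u <= a].
Proof.
move=> r_ninfty r_closed X_closed H_cont u clu.
have Xu : dom r u.
  by apply: X_closed => B /clu[v [[Xv _] Bv]]; exists v.
split=> //; rewrite -lerBrDr -lee_fin fineK; last exact: dom_fin_num.
have phi_cont : (v, a - H v) @[v --> u] --> (u, a - H u).
  have Hu : H v @[v --> u] --> H u by exact: H_cont.
  have aHu : a - H v @[v --> u] --> a - H u.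
    exact: (cvgB (cvg_cst a) Hu).
  exact: (@cvg_pair U U R (nbhs u) (nbhs u) (nbhs (a - H u)) _ _ _ id _
    cvg_id aHu).
apply: (r_closed (u, a - H u)) => B /phi_cont /clu[v [[Xv rv] Bv]].
exists (v, a - H v); split=> //=.
by rewrite -(fineK (dom_fin_num r_ninfty Xv)) lee_fin lerBrDr.
Qed.

Definition fine_bregman w (x u : U) : R :=
  fine (w u) - fine (w x) - 'd (fine \o w) x (u - x).

Definition prox_objective f r w (lambda : R) (x u : U) : R :=
  fine (f u) + fine (r u) + lambda^-1 * fine_bregman w x u.

(** The Bregman term differs from [w] by an affine function. *)
Lemma bregman_with_modulus (X : set U) w x :
  convex_with_modulus X 1 (fine \o w) ->
  convex_with_modulus X 1 (fine_bregman w x).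
Proof.
move=> w_convex t u v Xu Xv t0 t1.
have [Xz wz] := w_convex t u v Xu Xv t0 t1; split=> //.
have -> : fine_bregman w x (t *: u + (1 - t) *: v) =
  fine (w (t *: u + (1 - t) *: v)) - (t * fine (w u) + (1 - t) * fine (w v))
  + (t * fine_bregman w x u + (1 - t) * fine_bregman w x v).
  rewrite /fine_bregman.
  have -> : t *: u + (1 - t) *: v - x = t *: (u - x) + (1 - t) *: (v - x).
    by rewrite !scalerBr addrACA -opprD -scalerDl (addrC t) subrK scale1r.
  by rewrite linearD !linearZ /=; rewrite /GRing.scale/=; ring.
by move: wz => /=; lra.
Qed.

Lemma prox_objectiveE f r w lambda x u : (forall v, r v != -oo%E) ->
  dom r u -> f u \is a fin_num -> w u \is a fin_num -> w x \is a fin_num ->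
  (composite r f u + lambda^-1%:E * bregman w u x)%E =
  (prox_objective f r w lambda x u)%:E.
Proof.
move=> r_ninfty Xu f_fin wu wx.
rewrite /composite patchT ?inE// /bregman -(fineK wu) -(fineK wx).
rewrite -(fineK f_fin).
by rewrite -(fineK (dom_fin_num r_ninfty Xu)).
Qed.

(** Off [dom r] the extended-valued objective is [+oo], so its minimizers are
those of the real-valued objective on [dom r]. *)
Lemma proxP f r w lambda x : (forall u, r u != -oo%E) ->
  (forall u, dom r u -> f u \is a fin_num) ->
  (forall u, w u != -oo%E) -> (forall u, dom r u -> w u \is a fin_num) ->
  dom r x -> 0 < lambda ->
  (exists2 p, dom r p & forall u, dom r u ->
     prox_objective f r w lambda x p <= prox_objective f r w lambda x u) ->
  let p := prox (composite r f) w x lambda in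
  dom r p /\ forall u, dom r u ->
    prox_objective f r w lambda x p <= prox_objective f r w lambda x u.
Proof.
move=> r_ninfty f_fin w_ninfty w_fin Xx lambda0 [p0 Xp0 p0_min].
set obj := fun u => (composite r f u + lambda^-1%:E * bregman w u x)%E.
have objE u : dom r u -> obj u = (prox_objective f r w lambda x u)%:E.
  by move=> Xu; apply: prox_objectiveE; rewrite ?f_fin ?w_fin.
have obj_off u : ~ dom r u -> obj u = +oo%E.
  move=> Xu; rewrite /obj /composite patchC ?inE// addye//.
  rewrite /bregman -(fineK (w_fin _ Xx)).
  case: (w u) (w_ninfty u) => [a _| _|//].
    by rewrite -!EFinB -EFinM.
  by rewrite /= gt0_muley// lte_fin invr_gt0.
have p0_argmin : argmin obj p0.
  move=> v; have [Xv|Xv] := pselect (dom r v); last first.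
    by rewrite (obj_off v)// leey.
  by rewrite !objE// lee_fin p0_min.
move=> p; have p_argmin : argmin obj p by exact: xgetI p0_argmin.
have Xp : dom r p.
  apply: contrapT => Xp; have := p_argmin p0.
  by rewrite (obj_off _ Xp) objE// leye_eq.
split=> // u Xu; have := p_argmin u.
by rewrite !objE// lee_fin.
Qed.

End ExtendedValued.

(** * The proximal objective *)

Section ProximalStep.
Context {R : realType} {U V : normedModType R}.

Lemma prox_objective_with_modulus (X : set U) (f r w : U -> \bar R)
    (gamma lambda : R) (x : U) :
  0 < lambda -> convex_with_modulus X (- gamma) (fine \o f) ->
  convex_with_modulus X 0 (fine \o r) -> convex_with_modulus X 1 (fine \o w) ->
  convex_with_modulus X (lambda^-1 - gamma) (prox_objective f r w lambda x).
Proof.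
move=> lambda0 fX rX wX.
have -> : lambda^-1 - gamma = - gamma + 0 + lambda^-1 * 1.
  by rewrite addr0 mulr1 addrC.
apply: convex_with_modulusD; first exact: convex_with_modulusD fX rX.
apply: convex_with_modulusZ; first by rewrite invr_ge0 ltW.
exact: bregman_with_modulus.
Qed.

(** The Bregman term grows at least like [|u - x|^2 / (2 * lambda)], so the
sublevel sets are bounded; they are closed as intersections over [y] of
sublevel sets of [r] plus a continuous function. *)
Lemma prox_objective_attains_min (Y : set V) (g : V -> R) (Phi : U -> V -> R)
    (r w : U -> \bar R) (lambda m : R) (x : U) :
  finite_dimensional U -> (forall u, r u != -oo%E) -> closed_function r ->
  closed (dom r) -> Y !=set0 ->
  (forall u, dom r u -> fmax Y g Phi u \is a fin_num) ->
  (forall u y, dom r u -> Y y -> {for u, continuous (Phi ^~ y)}) ->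
  convex_with_modulus (dom r) 1 (fine \o w) ->
  (forall u, dom r u -> differentiable (fine \o w) u) ->
  (forall u, dom r u -> m <= fine (fmax Y g Phi u) + fine (r u)) ->
  0 < lambda -> dom r x ->
  exists2 p, dom r p & forall u, dom r u ->
    prox_objective (fmax Y g Phi) r w lambda x p <=
    prox_objective (fmax Y g Phi) r w lambda x u.
Proof.
move=> finU r_ninfty r_closed X_closed [y0 Yy0] f_fin Phi_cont w_convex w_diff.
move=> m_le lambda0 Xx; set F := prox_objective _ _ _ _ _.
have lambdaV0 : 0 < lambda^-1 by rewrite invr_gt0.
have F_ge u : dom r u -> m + lambda^-1 * (2^-1 * `|u - x| ^+ 2) <= F u.
  move=> Xu; apply: lerD; first exact: m_le.
  rewrite ler_pM2l//.
  exact: (strongly_convex_gradient_ineq w_convex Xx (w_diff x Xx) Xu).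
apply: coercive_lsc_attains_min => //; first by exists x.
- exists m => u /F_ge; apply: le_trans.
  by rewrite lerDl !mulr_ge0// ltW.
- move=> a; exists (`|x| + (1 + 2 * lambda * (a - m))).
  split=> [|N /ltW N_ge u [Xu Fu]]; first by rewrite num_real.
  apply: le_trans N_ge; rewrite -{1}(subrK x u) addrC.
  apply: le_trans (ler_normD _ _) _; rewrite lerD2l.
  have := le_trans (F_ge _ Xu) Fu.
  rewrite -lerBrDl ler_pdivrMl// -(ler_pM2l (ltr0n _ 2)) mulrA divff// mul1r.
  (* a square at most [b] has a root at most [1 + b] *)
  by have := sqr_ge0 (`|u - x| - 1); nra.
- move=> a.
  pose H y u := Phi u y - g y + lambda^-1 * fine_bregman w x u.
  have -> : [set u | dom r u /\ F u <= a] =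
      \bigcap_(y in Y) [set u | dom r u /\ fine (r u) + H y u <= a].
    apply/seteqP; split=> u.
      move=> [Xu Fu] y Yy; split=> //; apply: le_trans Fu.
      have := le_fine_fmax (f_fin u Xu) Yy; rewrite /F /prox_objective /H; lra.
    move=> Hu; have [Xu _] := Hu y0 Yy0; split=> //.
    suff : fine (fmax Y g Phi u) <=
        a - fine (r u) - lambda^-1 * fine_bregman w x u.
      rewrite /F /prox_objective; lra.
    apply/fine_fmax_le => [|y Yy]; first exact: f_fin.
    by have [_] := Hu y Yy; rewrite /H; lra.
  apply: closed_bigI => y Yy; apply: closed_sublevelD => // u Xu.
  apply: cvgD.
    by apply: cvgB; [exact: Phi_cont|exact: cvg_cst].
  apply: cvgMl_tmp; apply: cvgB.
    apply: cvgB; last exact: cvg_cst.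
    exact: differentiable_continuous (w_diff u Xu).
  apply: (@continuous_comp U U R (fun v => v - x) ('d (fine \o w) x) u).
    by apply: cvgB; [exact: cvg_id|exact: cvg_cst].
  exact: (diff_continuous (w_diff x Xx)).
Qed.

End ProximalStep.

(** * Error due to smoothing *)

Section Smoothing.
Context {R : realType} {U V : normedModType R}.
Variables (Y : set V) (g : V -> R) (Phi : U -> V -> R).

Lemma fine_fmax_perturb (g' : V -> R) delta x :
  fmax Y g Phi x \is a fin_num -> fmax Y g' Phi x \is a fin_num ->
  (forall y, Y y -> `|g' y - g y| <= delta) ->
  `|fine (fmax Y g' Phi x) - fine (fmax Y g Phi x)| <= delta.
Proof.
move=> fin_g fin_g' g'g; rewrite ler_norml; apply/andP; split.
  rewrite lerNl opprB lerBlDr; apply/fine_fmax_le => // y Yy.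
  have := le_fine_fmax fin_g' Yy; have := g'g y Yy; rewrite ler_norml; lra.
rewrite lerBlDr; apply/fine_fmax_le => // y Yy.
have := le_fine_fmax fin_g Yy; have := g'g y Yy; rewrite ler_norml; lra.
Qed.

Lemma fmax_fin_num_cont x : Y !=set0 -> compact Y -> {within Y, continuous g} ->
  {within Y, continuous (Phi x)} -> fmax Y g Phi x \is a fin_num.
Proof.
move=> Y0 Y_compact g_cont Phi_cont.
have [|y0 _ y0_max] :=
    @compact_EVT_max _ _ (fun y => Phi x y - g y) Y Y0 Y_compact.
  by move=> y; apply: cvgB; [exact: Phi_cont|exact: g_cont].
apply: (@fmax_fin_num _ _ _ Y g Phi x _ Y0) => y Yy.
by apply: y0_max; exact: mem_set.
Qed.

Lemma DGF_radius_fin (wY : V -> \bar R) : (0 < DGF_radius Y wY)%E ->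
  (DGF_radius Y wY < +oo)%E ->
  0 < fine (DGF_radius Y wY) /\ forall y, Y y -> wY y \is a fin_num /\
    `|fine (wY y)| <= fine (DGF_radius Y wY).
Proof.
move=> rad0 radoo.
have rad_fin : DGF_radius Y wY \is a fin_num.
  by rewrite fin_numElt radoo (lt_trans _ rad0)// ltNy0.
split=> [|y Yy]; first by rewrite fine_gt0// rad0.
have wy : (`|wY y| <= DGF_radius Y wY)%E by apply: ereal_sup_ubound; exists y.
have wy_fin : wY y \is a fin_num by rewrite fin_num_abs (le_lt_trans wy).
by split=> //; rewrite -lee_fin (fineK rad_fin) -abse_EFin fineK.
Qed.

End Smoothing.

(** * Near-stationarity of the output *)

Section InexactProximalStep.
Context {R : realType} {U : normedModType R}.

(** With [s := eps * lambda / beta] the choice of [eta] makes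
[eta / (lambda^-1 - gamma) = s^2 / 32]. So the stopping tolerance is exactly
[s / 4], and quadratic growth at a [5 * eta]-minimizer gives a distance of at
most [sqrt (5 / 16) * s <= 3 / 4 * s] to the minimizer. *)
Lemma near_proximal_point (xK y p : U) (eps lambda gamma beta eta : R) :
  0 < eps -> 0 < lambda -> 0 < beta -> 0 < 1 - gamma * lambda ->
  eta = eps ^+ 2 * lambda * (1 - gamma * lambda) / (32 * beta ^+ 2) ->
  `|y - xK| <= Num.sqrt (2 * eta / (lambda^-1 - gamma)) ->
  (lambda^-1 - gamma) / 2 * `|y - p| ^+ 2 <= 5 * eta ->
  `|xK - p| <= eps * lambda / beta.
Proof.
move=> eps0 lambda0 beta0 gl0 etaE y_near y_growth.
set s := eps * lambda / beta; set c := lambda^-1 - gamma in y_near y_growth.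
have s0 : 0 < s by rewrite divr_gt0// mulr_gt0.
have c0 : 0 < c.
  by rewrite subr_gt0 -(ltr_pM2r lambda0) mulVf ?gt_eqF// -subr_gt0.
have eta_s : eta = c * (s ^+ 2 / 32).
  by rewrite etaE /s /c; field; rewrite !gt_eqF.
have -> : s = s / 4 + 3 * s / 4 by field.
rewrite -(subrK y xK) -addrA (le_trans (ler_normD _ _))// lerD//.
  rewrite distrC (le_trans y_near)// -(ger0_norm (ltW (divr_gt0 s0 _)))//.
  rewrite -sqrtr_sqr ler_wsqrtr// eta_s le_eqVlt; apply/orP; left; apply/eqP.
  by field; rewrite gt_eqF.
rewrite eta_s in y_growth.
have {}y_growth : `|y - p| ^+ 2 <= 5 * s ^+ 2 / 16.
  by rewrite -(ler_pM2l c0); lra.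
have s34_ge0 : 0 <= 3 * s / 4 by lra.
rewrite -ler_sqr ?nnegrE//; have := sqr_ge0 s; lra.
Qed.

End InexactProximalStep.

Theorem theorem4p1 (R : realType) (U V : normedModType R)
  (finU : finite_dimensional U) (finV : finite_dimensional V)
  (r : U -> \bar R) (X : set U) (Y : set V) (g : V -> R)
  (X' : set U) (Y' : set V) (Phi : U -> V -> R)
  (Lxx Lxy Lyy gamma : R)
  (wX : U -> \bar R) (wY : V -> \bar R) (beta : R)
  (* the regularizer r and its domain *)
  (r_ninfty : forall x, r x != -oo%E)
  (r_closed : closed_function r)
  (r_convex : convex_efunction r)
  (X_dom : X = dom r)
  (X_nonempty : X !=set0) (X_closed : closed X) (X_convex : convex_set X)
  (* the dual feasible set and g *)
  (Y_nonempty : Y !=set0) (Y_convex : convex_set Y) (Y_compact : compact Y)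
  (g_convex : convex_function Y g) (g_cont : {within Y, continuous g})
  (* the coupling function *)
  (X'_open : open X') (X_sub : X `<=` X')
  (Y'_open : open Y') (Y_sub : Y `<=` Y')
  (Phi_cont : {within X' `*` Y', continuous (fun z : U * V => Phi z.1 z.2)})
  (Phi_concave : forall x, X x -> convex_function Y (fun y => - Phi x y))
  (q_bounded : (-oo < ereal_inf (range (composite r (fmax Y g Phi))))%E)
  (* smoothness in the primal variable *)
  (Phi_diffx : forall x y, X' x -> Y y -> differentiable (Phi ^~ y) x)
  (Phi_Lxx : forall x x' y, X x -> X x' -> Y y ->
    dual_norm ('d (Phi ^~ y) x \- 'd (Phi ^~ y) x') <= Lxx * `|x - x'|)
  (Phi_xLxy : forall x y y', X x -> Y y -> Y y' ->
    dual_norm ('d (Phi ^~ y) x \- 'd (Phi ^~ y') x) <= Lxy * `|y - y'|)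
  (* weak convexity in the primal variable *)
  (gamma_gt0 : 0 < gamma) (gamma_le : gamma <= Lxx)
  (Phi_weakly_convex : forall x x' y, X x -> X x' -> Y y ->
    - (gamma / 2) * `|x' - x| ^+ 2
      <= Phi x' y - Phi x y - 'd (Phi ^~ y) x (x' - x))
  (* smoothness in the dual variable *)
  (Phi_diffy : forall x y, X x -> Y' y -> differentiable (Phi x) y)
  (Phi_yLxy : forall x x' y, X x -> X x' -> Y y ->
    dual_norm ('d (Phi x) y \- 'd (Phi x') y) <= Lxy * `|x - x'|)
  (Phi_Lyy : forall x y y', X x -> Y y -> Y y' ->
    dual_norm ('d (Phi x) y \- 'd (Phi x) y') <= Lyy * `|y - y'|)
  (* the distance generating functions *)
  (wX_DGF : DGF X wX)
  (wX_C2 : C2_on (dom wX)° (fine \o wX))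
  (wX_dom : X `<=` (dom wX)°)
  (beta_ge1 : 1 <= beta)
  (wX_lip : forall x x', X x -> X x' ->
    dual_norm ('d (fine \o wX) x \- 'd (fine \o wX) x') <= beta * `|x - x'|)
  (wY_DGF : DGF Y wY)
  (wY_radius_gt0 : (0 < DGF_radius Y wY)%E)
  (wY_radius_fin : (DGF_radius Y wY < +oo)%E)
  (* the run of the algorithm *)
  (eps lambda : R) (x : nat -> U) (K : nat)
  (eps_gt0 : 0 < eps) (lambda_gt0 : 0 < lambda) (lambda_lt : lambda < gamma^-1)
  (run : smoothing_run r Y g Phi wX wY gamma
           (eps ^+ 2 * lambda * (1 - gamma * lambda) / (32 * beta ^+ 2))
           lambda x K) :
  let q := composite r (fmax Y g Phi) in
  `|x K - prox q wX (x K) lambda| <= eps * lambda / beta /\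
  near_stationary q wX X beta gamma eps (x K).
Proof.
move=> q; subst X.
have [K_ge1 X1 step _ stop] := run.
set eta := (X in 2 * X) in step stop.
have [wX_ninfty _ wX_convex [wX_C1 _]] := wX_DGF.
have beta0 : 0 < beta by exact: lt_le_trans beta_ge1.
have gl0 : 0 < 1 - gamma * lambda.
  by rewrite subr_gt0 -ltr_pdivlMl// mulr1.
have eta0 : 0 < eta by rewrite divr_gt0 ?mulr_gt0 ?exprn_gt0.
have XK : dom r (x K).
  case: K K_ge1 step {run stop} => [//|[//|k]] _ step.
  by have [] := step k.+1; rewrite ?ltnS// leqnSn.
have /andP[KK KK'] : (1 <= K <= K)%N by rewrite K_ge1 leqnn.
have [XK1 stepK] : dom r (x K.+1) /\ _ := step K (introT andP (conj KK KK')).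
have X_convex0 : convex_with_modulus (dom r) 0 (fun=> 0 : R).
  move=> t u v Xu Xv t0 t1.
  have [] := convex_efunction_with_modulus r_ninfty r_convex Xu Xv t0 t1.
  by split=> //; rewrite !(mulr0, mul0r, addr0, subr0).
have wX_fin u : dom r u -> wX u \is a fin_num.
  by move=> /wX_dom /interior_subset; exact: dom_fin_num.
have wX_diff u : dom r u -> differentiable (fine \o wX) u.
  by move=> /wX_dom /wX_C1[].
have wX_mod := strongly_convex1_with_modulus X_convex0 wX_fin wX_convex.
have Phi_cont_y u : dom r u -> {within Y, continuous (Phi u)}.
  move=> Xu; apply: continuous_in_subspaceT => y /set_mem Yy.
  by apply: differentiable_continuous; apply: Phi_diffy => //; exact: Y_sub.
have Phi_cont_x u y : dom r u -> Y y -> {for u, continuous (Phi ^~ y)}.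
  move=> Xu Yy; apply: differentiable_continuous.
  by apply: Phi_diffx => //; exact: X_sub.
have f_fin u : dom r u -> fmax Y g Phi u \is a fin_num.
  by move=> Xu; apply: fmax_fin_num_cont => //; exact: Phi_cont_y.
have [rad0 wY_bound] := DGF_radius_fin wY_radius_gt0 wY_radius_fin.
set rad := fine (DGF_radius Y wY) in step stepK rad0 wY_bound.
set rho := 2 * eta / rad in step stepK.
have rho0 : 0 < rho by rewrite divr_gt0// mulr_gt0.
pose g' y := g y + rho * fine (wY y).
have g'g y : Y y -> `|g' y - g y| <= 2 * eta.
  move=> Yy; have [_ wy] := wY_bound y Yy.
  rewrite /g' addrC addKr normrM gtr0_norm//.
  by rewrite (le_trans (ler_wpM2l (ltW rho0) wy))// /rho divfK// gt_eqF.
have f'E u : fmax_smooth Y g Phi wY rho u = fmax Y g' Phi u.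
  by apply: fmax_smoothE => y /wY_bound[].
have f'_fin u : dom r u -> fmax Y g' Phi u \is a fin_num.
  move=> Xu; apply: (@fmax_fin_num _ _ _ _ _ _ _
    (fine (fmax Y g Phi u) + 2 * eta)) => // y Yy.
  have := le_fine_fmax (f_fin u Xu) Yy; have := g'g y Yy.
  rewrite ler_norml; lra.
have [m m_le] : exists m, forall u, dom r u ->
    m <= fine (fmax Y g Phi u) + fine (r u).
  have [m m_inf] : exists m : R, (m%:E <= ereal_inf (range q))%E.
    case: (ereal_inf _) q_bounded => [m _|_|//]; first by exists m.
    by exists 0; exact: leey.
  exists m => u Xu; rewrite -lee_fin EFinD !fineK ?f_fin ?dom_fin_num//.
  apply: le_trans m_inf _; apply: ereal_inf_lbound; exists u => //.
  by rewrite /q /composite patchT// inE.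
have c_mod := prox_objective_with_modulus (x K) lambda_gt0
  (fmax_weakly_convex (fun x y => linearZ_LR ('d (Phi ^~ y) x)) X_convex0 f_fin
     Phi_weakly_convex)
  (convex_efunction_with_modulus r_ninfty r_convex) wX_mod.
have exists_min := prox_objective_attains_min finU r_ninfty r_closed X_closed
  Y_nonempty f_fin Phi_cont_x wX_mod wX_diff m_le lambda_gt0 XK.
have [Xp p_min] :=
  proxP r_ninfty f_fin wX_ninfty wX_fin XK lambda_gt0 exists_min.
rewrite -/q in Xp p_min; set p := prox q wX (x K) lambda in Xp p_min *.
(* Passing to the smoothed objective at [x K.+1] and back at [p] costs
[2 * eta] each, on top of the accuracy [eta] of the iterate. *)
have xK1_min : prox_objective (fmax Y g Phi) r wX lambda (x K) (x K.+1) <=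
    prox_objective (fmax Y g Phi) r wX lambda (x K) p + 5 * eta.
  have : (Qsmooth r Y g Phi wX wY rho lambda (x K.+1) (x K) <=
      Qsmooth r Y g Phi wX wY rho lambda p (x K) + eta%:E)%E.
    apply: le_trans stepK _; rewrite leeD2r//.
    by apply: ereal_inf_lbound; exists p.
  have -> : Qsmooth r Y g Phi wX wY rho lambda = fun u v =>
      (composite r (fmax Y g' Phi) u + lambda^-1%:E * bregman wX u v)%E.
    rewrite /Qsmooth (_ : fmax_smooth _ _ _ _ _ = fmax Y g' Phi)//.
    exact/funext.
  rewrite !prox_objectiveE ?f'_fin ?wX_fin// -EFinD lee_fin /prox_objective.
  have := fine_fmax_perturb (f_fin _ Xp) (f'_fin _ Xp) g'g.
  have := fine_fmax_perturb (f_fin _ XK1) (f'_fin _ XK1) g'g.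
  rewrite !ler_norml; lra.
have dist_p : `|x K - p| <= eps * lambda / beta.
  apply: (@near_proximal_point _ _ _ (x K.+1) _ _ _ gamma _ eta) => //.
  apply: le_trans (quadratic_growth c_mod Xp p_min XK1) _; lra.
split=> //; split=> //; exists lambda; split=> //.
rewrite normrZ gtr0_norm ?invr_gt0// ler_pdivrMl//.
by rewrite (le_trans dist_p)// mulrCA mulrA.
Qed.
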